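(* Let $u:X\to(0,\infty)$ be a strictly positive function. Then for all $\varphi\in C_c(X)$ we have (pointwise on $X\times X$) $$S_u(|\varphi|)\le S_u(\varphi),$$ and for all $\alpha,\beta\ge0$ $$S_u\big((-\alpha)\vee\varphi\wedge\beta\big)\le S_u(\varphi).$$ Moreover, if $p\ge2$, then $$S_u(\mathcal C\circ\varphi)\le S_u(\varphi)$$ for all normal contractions $\mathcal C$ and all $\varphi\in C_c(X)$.
   Context: Setting: $p\in(1,\infty)$; $X$ is an infinite countable set and $C_c(X)$ is the set of finitely supported functions $X\to\mathbb{R}$. $b:X\times X\to[0,\infty)$ is a connected graph: symmetric, zero diagonal, $\sum_y b(x,y)<\infty$ for all $x$, and any two vertices are joined by a finite path along which $b>0$. Write $\nabla_{xy}f=f(x)-f(y)$, $\vee=\max$, $\wedge=\min$. For $\varphi\in C_c(X)$ and $x,y\in X$, $$S_u(\varphi)_{xy}=b(x,y)u(x)u(y)|\nabla_{xy}\varphi|^2\left[|\nabla_{xy}u|\frac{|\varphi(x)|+|\varphi(y)|}{2}+(u(x)u(y))^{1/2}|\nabla_{xy}\varphi|\right]^{p-2},$$ where $0\cdot\infty=0$ if $1<p<2$. A normal contraction is a function $\mathcal C:\mathbb{R}\to\mathbb{R}$ with $\mathcal C(0)=0$ and $|\mathcal C(s)-\mathcal C(t)|\le|s-t|$ for all $s,t\in\mathbb{R}$. *)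

(* Defs.v *)
From mathcomp Require Import all_boot all_order all_algebra.
From mathcomp Require Import all_classical all_reals all_analysis.

Set Implicit Arguments.
Unset Strict Implicit.
Unset Printing Implicit Defensive.

Import Order.TTheory GRing.Theory Num.Theory.

Local Open Scope classical_set_scope.
Local Open Scope ring_scope.

Record connected_graph (R : realType) (X : countType) (b : X -> X -> R) : Prop :=
  ConnectedGraph {
    graph_ge0 : forall x y, 0 <= b x y;
    graph_sym : forall x y, b x y = b y x;
    graph_diag : forall x, b x x = 0;
    graph_summable : forall x, (\esum_(y in [set: X]) (b x y)%:E < +oo)%E;
    graph_connected : forall x y,
      exists2 s : seq X, path (fun v w => 0 < b v w) x s & last x s = y
  }.

Definition finitely_supported (R : realType) (X : countType) (f : X -> R) : Prop :=
  finite_set [set x | f x != 0].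

Definition grad (R : realType) (X : countType) (f : X -> R) (x y : X) : R :=
  f x - f y.

(* For u > 0 the bracket vanishes only if grad phi x y = 0. If 1 < p < 2, its
   negative power is then the infinite factor of the convention 0 * oo = 0;
   since powR takes finite values everywhere (0 `^ r = 0 for r != 0), the
   product is 0 here too. *)
Definition energy_density (R : realType) (X : countType) (b : X -> X -> R) (p : R)
    (u : X -> R) (phi : X -> R) (x y : X) : R :=
  b x y * u x * u y * `|grad phi x y| ^+ 2 *
  (`|grad u x y| * ((`|phi x| + `|phi y|) / 2) +
   Num.sqrt (u x * u y) * `|grad phi x y|) `^ (p - 2).

Definition normal_contraction (R : realType) (C : R -> R) : Prop :=
  C 0 = 0 /\ forall s t, `|C s - C t| <= `|s - t|.

(* Main.v *)
Require Import Defs.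
From mathcomp Require Import all_boot all_order all_algebra.
From mathcomp Require Import all_classical all_reals all_analysis.
From mathcomp Require Import ring lra.

Set Implicit Arguments.
Unset Strict Implicit.
Unset Printing Implicit Defensive.

Import Order.TTheory GRing.Theory Num.Theory.

Local Open Scope classical_set_scope.
Local Open Scope ring_scope.

(** Fix an edge and write D for the modulus of the gradient of phi along it, M
    for the mean of |phi| at its ends, B for the bracket, which is a linear form
    in D and M, and D', M', B' for the same quantities after the contraction.
    If p >= 2 the density is increasing in both D and M, and a normal
    contraction decreases both. If p < 2 it is decreasing in M; but since
    D^2 B^(p-2) = D^p (B / D)^(p-2) with B / D affine increasing in M / D, it is
    enough that D' <= D and D' / M' <= D / M. For the modulus M' = M. For a
    truncation, if phi changes sign along the edge then D / M = 2, the largest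
    value of such a ratio; otherwise use that the truncation, as a function of
    |s| on either half-line, is concave in modulus and vanishes at 0. *)

(** Once the negative powers are cleared, [z ^+ 2 = z]^ p * z [^ (2 - p)] turns the claim into a
    product of two comparisons with nonnegative exponents: [D'] with [D], and [D' * B] with
    [D * B']. *)
Lemma sqr_powR_le (R : realType) (p D D' B B' : R) : 1 < p <= 2 ->
    0 <= D' <= D -> 0 <= B -> 0 <= B' ->
    (0 < D' -> 0 < B /\ 0 < B') -> D' * B <= D * B' ->
  D' ^+ 2 * B' `^ (p - 2) <= D ^+ 2 * B `^ (p - 2).
Proof.
move=> /andP[p1 p2] /andP[D'0 D'D] B0 B'0 Bpos DB.
(* Here the brackets may vanish, so no division is possible; the left side is 0. *)
have [D'eq0|D'n0] := eqVneq D' 0.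
  by rewrite D'eq0 expr0n mul0r mulr_ge0 ?powR_ge0 // exprn_ge0 // -D'eq0.
have D'p : 0 < D' by rewrite lt_def D'n0.
have Dp : 0 < D := lt_le_trans D'p D'D.
have [Bp B'p] := Bpos D'p.
have sqrE (z : R) : 0 < z -> z ^+ 2 = z `^ p * z `^ (2 - p).
  move=> z0; rewrite -powR_mulrn ?ltW // -powRD; last by rewrite (gt_eqF z0) implybT.
  by congr (_ `^ _); ring.
rewrite -opprB !powRN ler_pdivrMr ?powR_gt0 // mulrAC ler_pdivlMr ?powR_gt0 //.
have D0 := ltW Dp; have p0 : 0 <= p by lra.
rewrite !sqrE // -!mulrA -!powRM //; apply: ler_pM; rewrite ?powR_ge0 //.
  by rewrite ge0_ler_powR.
by rewrite ge0_ler_powR ?nnegrE ?mulr_ge0 // subr_ge0.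
Qed.

Lemma normal_contraction_norm_le (R : realType) (C : R -> R) (s : R) :
  normal_contraction C -> `|C s| <= `|s|.
Proof. by move=> [C0 Cle]; rewrite -[C s]subr0 -[s in leRHS]subr0 -[in leLHS]C0. Qed.

Lemma normal_contraction_norm (R : realType) :
  normal_contraction (fun s : R => `|s|).
Proof. by split=> [|s t]; rewrite ?normr0 ?ler_dist_dist. Qed.

Definition truncate (R : realType) (alpha beta s : R) : R :=
  Num.min (Num.max (- alpha) s) beta.

(** Splits the truncation into affine pieces, so that later inequalities become arithmetic case by
    case. *)
Lemma truncateP (R : realType) (alpha beta s : R) : 0 <= alpha -> 0 <= beta ->
  let T := truncate alpha beta in
  [\/ [/\ T s = s, - alpha <= s & s <= beta],
      T s = - alpha /\ s <= - alpha | T s = beta /\ beta <= s].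
Proof.
move=> alpha0 beta0; rewrite /truncate /=.
have [als|/ltW sal] := leP (- alpha) s.
  by have [sb|/ltW bs] := leP s beta; [constructor 1|constructor 3].
have ab : - alpha <= beta by lra.
by rewrite min_l //; constructor 2.
Qed.

Lemma normal_contraction_truncate (R : realType) (alpha beta : R) :
  0 <= alpha -> 0 <= beta -> normal_contraction (truncate alpha beta).
Proof.
move=> alpha0 beta0; have T s := truncateP s alpha0 beta0.
split=> [|s t]; first by case: (T 0) => [[->]|[-> ?]|[-> ?]] //; lra.
have st := ler_norm (s - t); have ts := ler_norm (t - s).
rewrite (distrC t s) in ts; rewrite ler_norml.
by case: (T s) => [[-> ? ?]|[-> ?]|[-> ?]];
  case: (T t) => [[-> ? ?]|[-> ?]|[-> ?]]; apply/andP; split; lra.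
Qed.

(** The comparison of D / M before and after truncation, cross-multiplied so that zero denominators
    are harmless. *)
Lemma truncate_ratio_le (R : realType) (alpha beta s t : R) :
    0 <= alpha -> 0 <= beta -> let T := truncate alpha beta in
  (`|s| + `|t|) * `|T s - T t| <= (`|T s| + `|T t|) * `|s - t|.
Proof.
move=> alpha0 beta0 /=; set T := truncate alpha beta.
have TP z : [\/ [/\ T z = z, - alpha <= z & z <= beta],
  T z = - alpha /\ z <= - alpha | T z = beta /\ beta <= z].
  exact: truncateP.
wlog le_st : s t / s <= t => [wl|].
  have [/wl//|/ltW/wl] := leP s t.
  by rewrite addrC (addrC `|T t|) distrC (distrC t s).
rewrite (ler0_norm (x := s - t)) ?subr_le0 // opprB.
(* For opposite signs [|s| + |t| = |s - t|], and the triangle inequality for [T s] and [T t]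
   suffices. *)
have [st|st] := leP (s * t) 0.
  have s0 : s <= 0 by rewrite leNgt; apply/negP => s0; nra.
  have t0 : 0 <= t by rewrite leNgt; apply/negP => t0; nra.
  rewrite (ler0_norm s0) (ger0_norm t0) mulrC (addrC (- s)).
  by rewrite ler_wpM2r ?ler_normB ?subr_ge0.
have leT : T s <= T t.
  by case: (TP s) => [[-> ? ?]|[-> ?]|[-> ?]];
    case: (TP t) => [[-> ? ?]|[-> ?]|[-> ?]]; lra.
rewrite (ler0_norm (x := T s - T t)) ?subr_le0 // opprB.
(* For [0 <= s <= t] the claim expands to [s * T t <= t * T s]; for [s <= t <= 0] it expands to
   [t * T s <= s * T t]. *)
have [s0|/ltW s0] := leP 0 s.
  have t0 : 0 <= t := le_trans s0 le_st.
  have T0 z : 0 <= z -> 0 <= T z.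
    by move=> z0; case: (TP z) => [[-> ? ?]|[-> ?]|[-> ?]]; lra.
  rewrite (ger0_norm s0) (ger0_norm t0) !ger0_norm ?T0 //.
  by case: (TP s) => [[-> ? ?]|[-> ?]|[-> ?]];
    case: (TP t) => [[-> ? ?]|[-> ?]|[-> ?]]; nra.
have t0 : t <= 0 by rewrite leNgt; apply/negP => t0; nra.
have T0 z : z <= 0 -> T z <= 0.
  by move=> z0; case: (TP z) => [[-> ? ?]|[-> ?]|[-> ?]]; lra.
rewrite (ler0_norm s0) (ler0_norm t0) !ler0_norm ?T0 //.
by case: (TP s) => [[-> ? ?]|[-> ?]|[-> ?]];
  case: (TP t) => [[-> ? ?]|[-> ?]|[-> ?]]; nra.
Qed.

Section EnergyDensity.
Variables (R : realType) (X : countType) (b : X -> X -> R) (u : X -> R).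
Hypotheses (b_ge0 : forall x y, 0 <= b x y) (u_gt0 : forall x, 0 < u x).

Lemma energy_density_comp_ge2 (p : R) (C : R -> R) (phi : X -> R) (x y : X) :
    2 <= p -> normal_contraction C ->
  energy_density b p u (C \o phi) x y <= energy_density b p u phi x y.
Proof.
move=> p2 Cn; have Cle s := normal_contraction_norm_le s Cn.
have coef0 : 0 <= b x y * u x * u y by rewrite !mulr_ge0 // ltW.
rewrite /energy_density /grad /=; apply: ler_pM.
- by rewrite mulr_ge0.
- exact: powR_ge0.
- by rewrite ler_wpM2l // lerXn2r ?nnegrE ?Cn.2.
apply: ge0_ler_powR.
- by rewrite subr_ge0.
- by rewrite nnegrE addr_ge0 ?mulr_ge0 ?sqrtr_ge0 ?addr_ge0 ?invr_ge0.
- by rewrite nnegrE addr_ge0 ?mulr_ge0 ?sqrtr_ge0 ?addr_ge0 ?invr_ge0.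
by rewrite lerD ?ler_wpM2l ?sqrtr_ge0 ?Cn.2 // ler_wpM2r ?invr_ge0 ?lerD.
Qed.

Lemma energy_density_comp (p : R) (C : R -> R) (phi : X -> R) (x y : X) :
    1 < p -> normal_contraction C ->
    (forall s t, (`|s| + `|t|) * `|C s - C t| <= (`|C s| + `|C t|) * `|s - t|) ->
  energy_density b p u (C \o phi) x y <= energy_density b p u phi x y.
Proof.
move=> p1 Cn Cratio; have [p2|/ltW p2] := leP 2 p.
  exact: energy_density_comp_ge2.
have coef0 : 0 <= b x y * u x * u y by rewrite !mulr_ge0 // ltW.
rewrite /energy_density /grad /= -![b x y * _ * _ * _ * _]mulrA ler_wpM2l //.
have s0 : 0 < Num.sqrt (u x * u y) by rewrite sqrtr_gt0 mulr_gt0.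
apply: sqr_powR_le.
- by rewrite p1.
- by rewrite normr_ge0 Cn.2.
- by rewrite addr_ge0 ?mulr_ge0 ?sqrtr_ge0 ?addr_ge0 ?invr_ge0.
- by rewrite addr_ge0 ?mulr_ge0 ?sqrtr_ge0 ?addr_ge0 ?invr_ge0.
(* As [u] is positive, a nonzero gradient makes the square-root term of each bracket positive. *)
- move=> D'0; have D0 := lt_le_trans D'0 (Cn.2 _ _).
  by rewrite !ltr_wpDl ?mulr_gt0 ?mulr_ge0 ?addr_ge0 ?invr_ge0.
(* In [D' * B <= D * B'] the square-root terms agree on both sides; the rest is the ratio condition
   times half the modulus of the gradient of [u]. *)
have := ler_wpM2l (normr_ge0 (u x - u y)) (Cratio (phi x) (phi y)).
by set A := `|u x - u y|; lra.
Qed.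

End EnergyDensity.

Theorem lemma2p4 (R : realType) (p : R) (hp : 1 < p)
    (X : countType) (hX : infinite_set [set: X])
    (b : X -> X -> R) (hb : connected_graph b)
    (u : X -> R) (hu : forall x, 0 < u x) :
  (forall phi : X -> R, finitely_supported phi ->
     (forall x y, energy_density b p u (fun z => `|phi z|) x y
                  <= energy_density b p u phi x y)
     /\ (forall alpha beta : R, 0 <= alpha -> 0 <= beta ->
           forall x y,
             energy_density b p u
               (fun z => Num.min (Num.max (- alpha) (phi z)) beta) x y
             <= energy_density b p u phi x y))
  /\ (2 <= p ->
      forall C : R -> R, normal_contraction C ->
      forall phi : X -> R, finitely_supported phi ->
      forall x y, energy_density b p u (C \o phi) x y
                  <= energy_density b p u phi x y).
Proof.
have b0 := graph_ge0 hb; split=> [phi _|p2 C Cn phi _ x y]; last first.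
  exact: energy_density_comp_ge2.
split=> [x y|alpha beta alpha0 beta0 x y].
  apply: (energy_density_comp b0 hu (C := fun s => `|s|)) => // [|s t].
    exact: normal_contraction_norm.
  by rewrite !normr_id ler_wpM2l ?addr_ge0 // ler_dist_dist.
apply: (energy_density_comp b0 hu (C := truncate alpha beta)) => // [|s t].
  exact: normal_contraction_truncate.
exact: truncate_ratio_le.
Qed.
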